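(* Let $(T,v^* )$ be an infinite, transient, locally finite rooted tree. Then real-valued $1$-Lipschitz functions on $T$ are localized.
   Context: Trees are connected; transient means the simple random walk is transient. A real-valued $1$-Lipschitz function on a graph $G$ is a function $\phi:V(G)\to\mathbb{R}$ with $|\phi(u)-\phi(v)|\le1$ for every edge $(u,v)$. For a finite connected set $\Lambda\subset V(T)$ containing $v^*$, let $\partial\Lambda$ be the set of vertices outside $\Lambda$ adjacent to a vertex of $\Lambda$. The real-valued $1$-Lipschitz functions on the subtree induced on $\Lambda\cup\partial\Lambda$ that equal $0$ on $\partial\Lambda$ form a bounded convex polytope in $\mathbb{R}^{\Lambda}$; let $\phi_\Lambda$ be uniformly distributed on this polytope (with respect to Lebesgue measure). Real-valued $1$-Lipschitz functions on $T$ are localized if the family of laws of $\phi_\Lambda(v^* )$, over all finite connected $\Lambda\ni v^*$, is tight. *)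

(* Defs.v *)
From HB Require Import structures.
From mathcomp Require Import all_boot all_order all_algebra finmap.
From mathcomp Require Import all_classical all_reals all_analysis measurable_realfun.
Set Implicit Arguments.
Unset Strict Implicit.
Unset Printing Implicit Defensive.
Import Order.TTheory GRing.Theory Num.Theory.
Import numFieldNormedType.Exports.
Local Open Scope classical_set_scope.
Local Open Scope ring_scope.

Section Graph.
Variables (V : choiceType) (e : rel V).

Definition connected_on (A : set V) : Prop :=
  forall x y, A x -> A y ->
    exists p : seq V, [/\ path e x p, last x p = y & forall z, z \in p -> A z].

(* Every simple closed walk has length at most 2, that is, it is empty or
   runs back and forth along one edge (loops are excluded in [is_tree]). *)
Definition acyclic : Prop := forall c : seq V, ucycle e c -> (size c <= 2)%N.

Definition is_tree : Prop :=
  [/\ symmetric e, irreflexive e, connected_on [set: V] & acyclic].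

Definition locally_finite : Prop := forall x, finite_set [set y | e x y].

Definition degree (x : V) : nat := #|` fset_set [set y | e x y]|.

Definition outer_boundary (L : {fset V}) : set V :=
  [set y | y \notin L /\ exists2 x, x \in L & e x y].

End Graph.

Section RandomWalk.
Variables (R : realType) (V : choiceType) (e : rel V).

Definition srw_step (x y : V) : R := if e x y then (degree e x)%:R^-1 else 0.

(* The Markov property is stated for the joint laws
   P (X_0 = x_0, ..., X_n = x_n), which avoids conditioning on null events. *)
Definition simple_random_walk (d : measure_display) (Omega : measurableType d)
    (P : probability Omega R) (v : V) (X : nat -> Omega -> V) : Prop :=
  [/\ forall n x, measurable [set w | X n w = x],
      P [set w | X 0 w = v] = 1%E
    & forall (n : nat) (x : nat -> V),
        P [set w | forall i, (i <= n.+1)%N -> X i w = x i] =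
        (P [set w | forall i, (i <= n)%N -> X i w = x i] *
          (srw_step (x n) (x n.+1))%:E)%E].

(* All simple random walks started at [v] have the same law, so it does not
   matter which realization is taken. *)
Definition transient (v : V) : Prop :=
  exists (d : measure_display) (Omega : measurableType d)
         (P : probability Omega R) (X : nat -> Omega -> V),
    simple_random_walk P v X /\
    (P [set w | exists2 n, (0 < n)%N & X n w = v] < 1)%E.

End RandomWalk.

Section LebesgueTuple.
Variable R : realType.
Local Open Scope ereal_scope.

(* Lebesgue measure on R^n, as the n-fold product measure in iterated form. *)
Fixpoint lebesgue_tuple (n : nat) : set (n.-tuple R) -> \bar R :=
  match n with
  | 0 => fun A => \d_([tuple] : 0.-tuple R) A
  | n'.+1 => fun A => \int[@lebesgue_measure R]_x
               lebesgue_tuple [set t : n'.-tuple R | A [tuple of x :: t]]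
  end.

Let mR := measurableTypeR R.

Let cons_tuple n (p : mR * n.-tuple R) : n.+1.-tuple R := [tuple of p.1 :: p.2].
Let uncons_tuple n (t : n.+1.-tuple R) : mR * n.-tuple R :=
  (thead t, [tuple of behead t]).

Let measurable_cons_tuple n : measurable_fun [set: mR * n.-tuple R] (@cons_tuple n).
Proof.
apply: (@measurable_cons _ _ (mR * n.-tuple R)%type R fst n snd).
  exact: measurable_fst.
exact: measurable_snd.
Qed.

Let measurable_uncons_tuple n :
  measurable_fun [set: n.+1.-tuple R] (@uncons_tuple n).
Proof.
apply/measurable_fun_pairP; split.
  exact: (@measurable_tnth _ R n.+1 ord0).
exact: measurable_behead.
Qed.

Let lebesgue_tuple_measure n :
  exists m : {sigma_finite_measure set (n.-tuple R) -> \bar R},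
    forall A, m A = lebesgue_tuple A.
Proof.
elim: n => [|n [m mE]]; first by exists \d_([tuple] : 0.-tuple R).
pose mu : {measure set (n.+1.-tuple R) -> \bar R} :=
  measure_function_pushforward__canonical__measure_function_Measure
    (@lebesgue_measure R \x m)%E (@measurable_cons_tuple n).
have sf : sigma_finite [set: n.+1.-tuple R] mu.
  have /sigma_finiteP[F [FT ndF Foo]] := sigma_finiteT (@lebesgue_measure R).
  have /sigma_finiteP[G [GT ndG Goo]] := sigma_finiteT m.
  exists (fun i => @uncons_tuple n @^-1` (F i `*` G i)).
    rewrite -preimage_bigcup [X in _ @^-1` X](_ : _ = setT) ?preimage_setT//.
    rewrite -subTset => -[x t] _.
    have [k _ Fk] : (\bigcup_i F i) x by rewrite -FT.
    have [l _ Gl] : (\bigcup_i G i) t by rewrite -GT.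
    exists (maxn k l) => //; split => /=.
      by move: (x) Fk; exact/subsetPset/ndF/leq_maxl.
    by move: (t) Gl; exact/subsetPset/ndG/leq_maxr.
  move=> i; have [mFi Fioo] := Foo i; have [mGi Gioo] := Goo i; split.
    rewrite -[X in measurable X]setTI; apply: measurable_uncons_tuple => //.
    exact: measurableX.
  rewrite /mu /= /pushforward -comp_preimage (_ : _ \o _ = id)/=.
    by rewrite product_measure1E// lte_mul_pinfty// ge0_fin_numE.
  rewrite funeqE => -[x t] /=.
  rewrite /uncons_tuple theadE; congr pair; exact/val_inj.
pose mu' : {sigma_finite_measure set (n.+1.-tuple R) -> \bar R} :=
  HB.pack (Measure.sort mu) mu (Measure_isSigmaFinite.Build _ _ _ mu sf).
exists mu' => A; rewrite /= /mu /= /pushforward /product_measure1.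
apply: eq_integral => x _ /=; rewrite mE; congr lebesgue_tuple.
by apply/seteqP; split => t /=; rewrite /xsection /= inE.
Qed.

Let lebesgue_tuple0 n : lebesgue_tuple (@set0 (n.-tuple R)) = 0.
Proof. by have [m mE] := lebesgue_tuple_measure n; rewrite -mE measure0. Qed.

Let lebesgue_tuple_ge0 n (A : set (n.-tuple R)) : 0 <= lebesgue_tuple A.
Proof. by have [m mE] := lebesgue_tuple_measure n; rewrite -mE measure_ge0. Qed.

Let lebesgue_tuple_sigma_additive n :
  semi_sigma_additive (@lebesgue_tuple n).
Proof.
have [m /funext mE] := lebesgue_tuple_measure n.
by rewrite -mE; exact: measure_semi_sigma_additive.
Qed.

HB.instance Definition _ n := isMeasure.Build _ (n.-tuple R) R
  (@lebesgue_tuple n) (@lebesgue_tuple0 n) (@lebesgue_tuple_ge0 n)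
  (@lebesgue_tuple_sigma_additive n).

Let lebesgue_tuple_sigma_finite n :
  sigma_finite [set: n.-tuple R] (@lebesgue_tuple n).
Proof.
have [m /funext mE] := lebesgue_tuple_measure n.
by rewrite -mE; exact: sigma_finiteT.
Qed.

HB.instance Definition _ n := Measure_isSigmaFinite.Build _ (n.-tuple R) R
  (@lebesgue_tuple n) (@lebesgue_tuple_sigma_finite n).

Lemma lebesgue_tuple_box n (A : 'I_n -> set R) :
  (forall i, measurable (A i)) ->
  lebesgue_tuple [set t : n.-tuple R | forall i, A i (tnth t i)] =
  \prod_(i < n) @lebesgue_measure R (A i).
Proof.
elim: n A => [A _|n IH A mA].
  rewrite big_ord0 /= diracE mem_set//= => -[].
  by [].
rewrite big_ord_recl /=.
under eq_integral => x _.
  rewrite (_ : [set t : n.-tuple R | _] =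
     [set t | A ord0 x /\ forall i, A (lift ord0 i) (tnth t i)]); last first.
    apply/seteqP; split=> t /=.
      move=> H; split; first exact: (H ord0).
      by move=> i; have := H (lift ord0 i); rewrite tnthS.
    move=> [H0 H] i; case: (unliftP ord0 i) => [j ->|->]; last by [].
    by rewrite tnthS.
  over.
rewrite (eq_integral (fun x : mR => (\1_(A ord0) x)%:E *
    lebesgue_tuple [set t : n.-tuple R | forall i, A (lift ord0 i) (tnth t i)])).
  rewrite (@ge0_integralZr _ mR)//=.
  - rewrite (@integral_indic _ mR)//; last exact: mA.
    by congr (lebesgue_measure _ * _); [exact: setIT|exact: IH].
  - by apply/measurable_EFinP/measurable_indic; exact: mA.
move=> x _; rewrite indicE; have [xA|xA] := boolP (x \in A ord0).
  rewrite mul1e; congr lebesgue_tuple; apply/seteqP; split=> t /=; last first.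
    by move=> H; split => //; exact: set_mem.
  by case.
rewrite mul0e (_ : [set t | _] = set0) ?measure0//.
by apply/seteqP; split=> t //= [/mem_set]; rewrite (negbTE xA).
Qed.

End LebesgueTuple.

Section Localization.
Variable R : realType.

Definition uniform_law (n : nat) (A : set (n.-tuple R)) :
    set (n.-tuple R) -> \bar R :=
  fun B => (lebesgue_tuple (A `&` B) * ((fine (lebesgue_tuple A))^-1)%:E)%E.

Definition tight (I : Type) (D : set I) (m : I -> set R -> \bar R) : Prop :=
  forall eps : R, 0 < eps ->
    exists2 K : set R, compact K & forall i, D i -> (m i (~` K) <= eps%:E)%E.

Variables (V : choiceType) (e : rel V).

Definition lipschitz1_on (A : set V) (phi : V -> R) : Prop :=
  forall u v, A u -> A v -> e u v -> `|phi u - phi v| <= 1.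

(* R^L is encoded as tuples indexed by the enumeration of [L]. Outside [L],
   in particular on the outer boundary, [index] is out of range and the
   default value 0 is returned. *)
Definition extend0 (L : {fset V}) (t : #|` L|.-tuple R) (u : V) : R :=
  nth 0 t (index u L).

Definition lipschitz_polytope (L : {fset V}) : set (#|` L|.-tuple R) :=
  [set t | lipschitz1_on ([set` L] `|` outer_boundary e L) (extend0 t)].

Definition lipschitz_law (L : {fset V}) (v : V) : set R -> \bar R :=
  pushforward (uniform_law (@lipschitz_polytope L)) (fun t => extend0 t v).

Definition localized (v : V) : Prop :=
  tight [set L : {fset V} | v \in L /\ connected_on e [set` L]]
        (fun L => lipschitz_law L v).

End Localization.

(* Main.v *)
Require Import Defs.
From mathcomp Require Import all_boot all_order all_algebra finmap.
From mathcomp Require Import all_classical all_reals all_analysis measurable_realfun.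
From mathcomp Require Import lra ring.

(* Call [f] k-decaying if it is even, nonnegative and [f x * exp (k (x - 1)_+^2)]
   is nonincreasing for [x >= 0]. Such functions behave like resistors on the
   tree. A product of k- and l-decaying functions is (k + l)-decaying, which is
   the parallel law. Convolution with the indicator of [-1, 1] turns k into
   k / (1 + k), which is the series law for a unit resistor; the offset 1 in the
   exponent cannot be dropped, because the convolution of a very concentrated
   [f] is flat on [-1, 1]. The indicator of [-1, 1], which a boundary neighbour
   contributes, is k-decaying for every k.

   Integrating out the vertices of Lambda from the leaves towards the root
   therefore shows that the density of the height at the root is k-decaying,
   where k is at least the effective conductance from the root to infinity with
   unit resistors. Transience makes it positive: the probability of ever hitting
   the root is a superharmonic voltage, from which the conductances are bounded
   below one vertex at a time. Finally, the law with a k-decaying density gives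
   mass at most 1 / (1 + k (M - 1)^2) to the complement of [-M, M]. *)

Set Implicit Arguments.
Unset Strict Implicit.
Unset Printing Implicit Defensive.
Import Order.TTheory GRing.Theory Num.Theory.
Import numFieldNormedType.Exports.
Local Open Scope classical_set_scope.
Local Open Scope ring_scope.

(** * Reflection invariance of Lebesgue measure *)

Section LebesgueReflection.
Context {R : realType}.
Implicit Types (c : R) (f : R -> \bar R).

Let mR := measurableTypeR R.

Lemma measurable_reflect c : measurable_fun [set: R] (fun t : R => c - t).
Proof. by apply: measurable_funB => //; exact: measurable_cst. Qed.

Lemma lebesgue_measure_reflect c (A : set R) : measurable A ->
  @lebesgue_measure R ((fun t : R => c - t) @^-1` A) = @lebesgue_measure R A.
Proof.
move=> mA; symmetry.
have mc : measurable_fun [set: mR] ((fun t : R => c - t) : mR -> mR).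
  exact: measurable_reflect.
pose mu : {measure set mR -> \bar R} :=
  measure_function_pushforward__canonical__measure_function_Measure
    (@lebesgue_measure R) mc.
apply: (@lebesgue_measure_unique R mu) => // _ [[a b] _ <-] /=.
rewrite /mu /= /pushforward.
have -> : (fun t : R => c - t) @^-1` `]a, b]%classic = `[c - b, c - a[%classic.
  by apply/seteqP; split => t /=; rewrite !in_itv/= => /andP[? ?]; apply/andP; split; lra.
rewrite !lebesgue_measure_itv/= !lte_fin.
have -> : (c - b < c - a) = (a < b) by apply/idP/idP; lra.
by case: ifP => // _; rewrite -!EFinB; congr EFin; ring.
Qed.

Lemma ge0_integral_reflect c f : measurable_fun [set: R] f ->
  (forall t, (0 <= f t)%E) ->
  (\int[@lebesgue_measure R]_t f (c - t)%R = \int[@lebesgue_measure R]_t f t)%E.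
Proof.
move=> mf f0.
have mc : measurable_fun [set: mR] ((fun t : R => c - t) : mR -> mR).
  exact: measurable_reflect.
have -> : (\int[@lebesgue_measure R]_t f t =
    \int[pushforward (@lebesgue_measure R) ((fun t : R => c - t)%R : mR -> mR)]_t f t)%E.
  apply: eq_measure_integral => A mA _ /=.
  by rewrite /pushforward lebesgue_measure_reflect.
by rewrite (ge0_integral_pushforward mc)//= => y _; exact: f0.
Qed.

(** A translation is the composition of two reflections. *)
Lemma ge0_integral_shift c f : measurable_fun [set: R] f ->
  (forall t, (0 <= f t)%E) ->
  (\int[@lebesgue_measure R]_t f (t + c)%R = \int[@lebesgue_measure R]_t f t)%E.
Proof.
move=> mf f0; rewrite -(@ge0_integral_reflect c f)//.
rewrite -(@ge0_integral_reflect 0 (fun t => f (c - t)%R))//; last first.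
  exact: measurableT_comp mf (measurable_reflect c).
by apply: eq_integral => t _; congr f; ring.
Qed.

End LebesgueReflection.

(** * Decaying functions and the parallel law *)

Section GaussianDecay.
Context {R : realType}.
Implicit Types (f g : R -> R) (k l x y t : R).

Definition excess x : R := Num.max (x - 1) 0.

(* First-order form of the monotonicity of [f x * exp (k * excess x ^ 2)]. *)
Record decay k f : Prop := Decay {
  decay_ge0 : forall x, 0 <= f x;
  decay_even : forall x, f (- x) = f x;
  decay_le : forall x y, 0 <= x -> x <= y ->
    f y * (1 + k * (excess y ^+ 2 - excess x ^+ 2)) <= f x }.

Definition box x : R := (`|x|%R <= 1)%R%:R.

Lemma excess_ge0 x : 0 <= excess x.
Proof. by rewrite /excess le_max lexx orbT. Qed.

Lemma excessE x : 1 <= x -> excess x = x - 1.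
Proof. by move=> x1; rewrite /excess max_l// subr_ge0. Qed.

Lemma excess0 x : x <= 1 -> excess x = 0.
Proof. by move=> x1; rewrite /excess max_r// subr_le0. Qed.

Lemma le_excess2 x y : x <= y -> excess x ^+ 2 <= excess y ^+ 2.
Proof.
move=> xy; rewrite lerXn2r ?nnegrE ?excess_ge0//.
by rewrite /excess ge_max !le_max lexx orbT andbT lerD2r xy.
Qed.

Lemma decay_noninc k f x y : 0 <= k -> decay k f -> 0 <= x -> x <= y -> f y <= f x.
Proof.
move=> k0 [f0 _ fle] x0 xy; apply: le_trans (fle _ _ x0 xy).
by rewrite ler_peMr// lerDl mulr_ge0// subr_ge0 le_excess2.
Qed.

Lemma decay_normr k f x : decay k f -> f `|x| = f x.
Proof. by move=> [_ fN _]; case: (ger0P x) => // _; rewrite fN. Qed.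

Lemma decay_le_norm k f x y : 0 <= k -> decay k f -> `|x| <= `|y| -> f y <= f x.
Proof.
move=> k0 df xy; rewrite -(decay_normr x df) -(decay_normr y df).
by apply: decay_noninc df _ xy => //.
Qed.

Lemma decay_le0 k f x : 0 <= k -> decay k f -> f x <= f 0.
Proof. by move=> k0 df; apply: (decay_le_norm k0 df); rewrite normr0. Qed.

Lemma decayW k l f : 0 <= l -> l <= k -> decay k f -> decay l f.
Proof.
move=> l0 lk [f0 fN fle]; split=> // x y x0 xy.
apply: le_trans (fle _ _ x0 xy); apply: ler_wpM2l => //.
by rewrite lerD2l ler_wpM2r// subr_ge0 le_excess2.
Qed.

(** The first-order forms multiply because [(1 + k d) (1 + l d) >= 1 + (k + l) d] for nonnegative
    [k], [l], [d]. *)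
Lemma decayM k l f g : 0 <= k -> 0 <= l -> decay k f -> decay l g ->
  decay (k + l) (fun x => f x * g x).
Proof.
move=> k0 l0 [f0 fN fle] [g0 gN gle]; split.
- by move=> x; rewrite mulr_ge0.
- by move=> x; rewrite fN gN.
move=> x y x0 xy; set d := _ - _.
have d0 : 0 <= d by rewrite subr_ge0 le_excess2.
have kd : 0 <= k * d by rewrite mulr_ge0.
have ld : 0 <= l * d by rewrite mulr_ge0.
apply: (@le_trans _ _ ((f y * (1 + k * d)) * (g y * (1 + l * d)))).
  rewrite mulrACA; apply: ler_wpM2l; first by rewrite mulr_ge0.
  by have := mulr_ge0 kd ld; nra.
by apply: ler_pM; [rewrite mulr_ge0// addr_ge0|rewrite mulr_ge0// addr_ge0|exact: fle|exact: gle].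
Qed.

Lemma decay_cst c : 0 <= c -> decay 0 (fun=> c).
Proof. by move=> c0; split=> // x y _ _; rewrite mul0r addr0 mulr1. Qed.

Lemma box_ge0 x : 0 <= box x. Proof. exact: ler0n. Qed.

Lemma boxN x : box (- x) = box x. Proof. by rewrite /box normrN. Qed.

Lemma decay_box k : 0 <= k -> decay k box.
Proof.
move=> k0; split=> [x|x|x y x0 xy]; [exact: box_ge0|exact: boxN|].
rewrite {1}/box ger0_norm ?(le_trans x0)//; case: (leP y 1) => y1; last first.
  by rewrite mul0r box_ge0.
by rewrite /box ger0_norm// (le_trans xy y1) !excess0 ?(le_trans xy)// subrr mulr0 addr0 mulr1.
Qed.

Lemma measurable_decay k f : 0 <= k -> decay k f -> measurable_fun [set: R] f.
Proof.
move=> k0 df.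
(* Cutting at 0 makes the outer function monotone on the whole line. *)
have -> : f = (fun x => f (Num.max x 0)) \o (fun x : R => `|x|).
  by apply/funext => x /=; rewrite max_l// (decay_normr _ df).
apply: measurableT_comp; last exact: normr_measurable.
apply: nonincreasing_measurable => // x y xy.
apply: (decay_noninc k0 df); first by rewrite le_max lexx orbT.
by rewrite ge_max !le_max xy lexx orbT.
Qed.

Lemma measurable_box : measurable_fun [set: R] box.
Proof. exact: measurable_decay (decay_box ler01). Qed.

(** As [box] is even, [t - x] can stand for [x - t]. For decaying [f] the integral is finite and
    [fine] loses nothing. *)
Definition conv_box f x : R :=
  fine (\int[@lebesgue_measure R]_t (f t * box (t - x))%:E)%E.

Lemma integral_box x : (\int[@lebesgue_measure R]_t (box (t - x))%:E = (2 : R)%:E)%E.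
Proof.
have -> : (fun t => (box (t - x))%:E) =
    (fun t => (\1_`[x - 1, x + 1]%classic t)%:E).
  apply/funext => t; rewrite indicE /box; congr ((_ : bool)%:R%:E).
  rewrite mem_setE in_itv/= ler_norml; apply/idP/idP => /andP[? ?]; apply/andP; split; lra.
rewrite (@integral_indic _ (measurableTypeR R))//.
rewrite setIT /= lebesgue_measure_itv/= lte_fin ifT; last by lra.
by rewrite -EFinB; congr EFin; ring.
Qed.

Lemma measurable_box_shift x : measurable_fun [set: R] (fun t => box (t - x)).
Proof.
apply: measurableT_comp measurable_box _.
by apply: measurable_funB => //; exact: measurable_cst.
Qed.

Lemma fin_num_integral_box f (M : R) x : (forall t, 0 <= f t) ->
  (forall t, `|t - x| <= 1 -> f t <= M) -> measurable_fun [set: R] f ->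
  (\int[@lebesgue_measure R]_t (f t * box (t - x))%:E)%E \is a fin_num.
Proof.
move=> f0 fM mf; rewrite ge0_fin_numE; last first.
  by apply: integral_ge0 => t _; rewrite lee_fin mulr_ge0 ?box_ge0.
apply: (@le_lt_trans _ _ (\int[@lebesgue_measure R]_t (`|M|%:E * (box (t - x))%:E))%E).
  apply: ge0_le_integral => //.
  - by move=> t _; rewrite lee_fin mulr_ge0 ?box_ge0.
  - apply/measurable_EFinP; apply: measurable_funM => //; exact: measurable_box_shift.
  - apply/measurable_EFinP; apply: measurable_funM => //; exact: measurable_box_shift.
  - move=> t _; rewrite -EFinM lee_fin /box; case: (boolP (`|t - x| <= 1)) => tx.
      by rewrite !mulr1 (le_trans (fM _ tx))// ler_norm.
    by rewrite !mulr0.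
rewrite (@ge0_integralZl_EFin _ (measurableTypeR R))//.
- by rewrite integral_box -EFinM ltry.
- by move=> t _; rewrite lee_fin box_ge0.
- by apply/measurable_EFinP; exact: measurable_box_shift.
Qed.

End GaussianDecay.

(** * The series law *)

Section Convolution.
Context {R : realType}.
Implicit Types (f g u v : R -> R) (k l x y t : R).

Local Notation mu := (@lebesgue_measure R).

(** Differences of integrals are compared in additive form, so that possibly infinite values are
    never subtracted. *)
Lemma le_integralD2 u1 u2 v1 v2 :
  (forall t, 0 <= u1 t) -> (forall t, 0 <= u2 t) ->
  (forall t, 0 <= v1 t) -> (forall t, 0 <= v2 t) ->
  measurable_fun [set: R] u1 -> measurable_fun [set: R] u2 ->
  measurable_fun [set: R] v1 -> measurable_fun [set: R] v2 ->
  (forall t, u1 t + u2 t <= v1 t + v2 t) ->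
  (\int[mu]_t (u1 t)%:E + \int[mu]_t (u2 t)%:E <=
   \int[mu]_t (v1 t)%:E + \int[mu]_t (v2 t)%:E)%E.
Proof.
move=> u10 u20 v10 v20 mu1 mu2 mv1 mv2 uv.
rewrite -!(@ge0_integralD _ (measurableTypeR R))//; try by
  [move=> t _; rewrite lee_fin|exact/measurable_EFinP].
apply: ge0_le_integral => //.
- by move=> t _; rewrite -EFinD lee_fin addr_ge0.
- by apply: emeasurable_funD; exact/measurable_EFinP.
- by apply: emeasurable_funD; exact/measurable_EFinP.
- by move=> t _; rewrite -!EFinD lee_fin.
Qed.

Section FixedDecay.
Variables (k : R) (f : R -> R).
Hypotheses (k0 : 0 <= k) (df : decay k f).

Let f0 : forall t, 0 <= f t. Proof. exact: decay_ge0 df. Qed.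
Let mf : measurable_fun [set: R] f. Proof. exact: measurable_decay df. Qed.

Lemma conv_boxE x :
  ((conv_box f x)%:E = \int[mu]_t (f t * box (t - x))%:E)%E.
Proof.
rewrite fineK//; apply: (fin_num_integral_box (M := f 0)) => // t _.
exact: decay_le0 df.
Qed.

Lemma conv_box_ge0 x : 0 <= conv_box f x.
Proof.
rewrite fine_ge0//; apply: integral_ge0 => t _.
by rewrite lee_fin mulr_ge0// box_ge0.
Qed.

Let mfb x : measurable_fun [set: R] (fun t => f t * box (t - x)).
Proof. by apply: measurable_funM => //; exact: measurable_box_shift. Qed.

Lemma conv_boxN x : conv_box f (- x) = conv_box f x.
Proof.
congr fine; rewrite -(@ge0_integral_reflect R 0)//.
- apply: eq_integral => t _; rewrite sub0r (decay_even df); congr (_ * _)%:E.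
  by rewrite -boxN; congr box; ring.
- by apply/measurable_EFinP; exact: mfb.
- by move=> t; rewrite lee_fin mulr_ge0// box_ge0.
Qed.

(** Reflection about [(x + y) / 2] exchanges the two windows. Averaging each integral with its
    reflection leaves, in the difference, a product of two factors that change sign together at the
    midpoint. *)
Lemma conv_box_noninc x y : 0 <= x -> x <= y -> conv_box f y <= conv_box f x.
Proof.
move=> x0 xy.
have mr : measurable_fun [set: R] (fun t => f (x + y - t)).
  by apply: measurableT_comp mf _; exact: measurable_reflect.
have fb0 z t : 0 <= f t * box (t - z) by rewrite mulr_ge0 ?box_ge0.
have reflE z : (\int[mu]_t (f (x + y - t) * box (t - (x + y - z)))%:E =
    \int[mu]_t (f t * box (t - z))%:E)%E.
  rewrite -[RHS](@ge0_integral_reflect R (x + y))//.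
  - apply: eq_integral => t _; congr (_ * _)%:E.
    by rewrite -boxN; congr box; ring.
  - by apply/measurable_EFinP; exact: mfb.
  - by move=> t; rewrite lee_fin.
have E : (\int[mu]_t (f t * box (t - y))%:E +
          \int[mu]_t (f (x + y - t) * box (t - x))%:E <=
          \int[mu]_t (f t * box (t - x))%:E +
          \int[mu]_t (f (x + y - t) * box (t - y))%:E)%E.
  apply: le_integralD2 => //; try by move=> t; rewrite mulr_ge0 ?box_ge0.
  - by apply: measurable_funM => //; exact: measurable_box_shift.
  - by apply: measurable_funM => //; exact: measurable_box_shift.
  move=> t; rewrite -subr_ge0.
  have -> : f t * box (t - x) + f (x + y - t) * box (t - y) -
      (f t * box (t - y) + f (x + y - t) * box (t - x)) =
      (f t - f (x + y - t)) * (box (t - x) - box (t - y)) by ring.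
  case: (lerP t ((x + y) / 2)) => tc.
    apply: mulr_ge0; rewrite subr_ge0.
      apply: (decay_le_norm k0 df); rewrite ler_normr ler_norml.
      by apply/orP; left; apply/andP; split; lra.
    rewrite /box; case: (boolP (`|t - y| <= 1)); last by rewrite ler0n.
    rewrite ler_norml => /andP[h1 h2]; rewrite (_ : `|t - x| <= 1)//.
    by rewrite ler_norml; apply/andP; split; lra.
  apply: mulr_le0; rewrite subr_le0.
    apply: (decay_le_norm k0 df); rewrite ler_normr ler_norml.
    by apply/orP; left; apply/andP; split; lra.
  rewrite /box; case: (boolP (`|t - x| <= 1)); last by rewrite ler0n.
  rewrite ler_norml => /andP[h1 h2]; rewrite (_ : `|t - y| <= 1)//.
  by rewrite ler_norml; apply/andP; split; lra.
have := reflE x; have := reflE y.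
rewrite (_ : x + y - y = x); last by ring.
rewrite (_ : x + y - x = y); last by ring.
move: E => /[swap] -> /[swap] ->.
by rewrite -!conv_boxE -!EFinD lee_fin; lra.
Qed.

Section Step.
(** The equation below says [k' = k / (1 + k)] in the form that is used: the weight [P] is at least
    [1 - k'], hence [k' <= P t * k]. *)
Variable k' : R.
Hypotheses (k'0 : 0 <= k') (k'1 : k' <= 1) (k'k : k' = (1 - k') * k).

(* The weight [P] below satisfies [P <= 1] exactly for [`|t - x| <= 1], so that
   inserting it only decreases the difference between the windows around [x] and
   [x + h]. Its curvature [2 * k'] makes [P t * f t - P (t + h) * f (t + h)] at
   least [2 * k' * h * (x - 1) * f (t + h)], uniformly over the window. *)
Lemma conv_box_step x h : 1 <= x -> 0 <= h ->
  conv_box f (x + h) * (1 + 2 * k' * h * (x - 1)) <= conv_box f x.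
Proof.
move=> x1 h0.
pose P t := 1 - k' * (1 - (t - x) ^+ 2).
have P0 t : 0 <= P t.
  by rewrite /P; have := sqr_ge0 (t - x); have := k'0; have := k'1; nra.
have mP : measurable_fun [set: R] P.
  apply: measurable_funB => //; apply: measurable_funM => //.
  apply: measurable_funB => //; apply: measurable_funX.
  by apply: measurable_funB.
have mPf : measurable_fun [set: R] (fun t => P t * f t) by exact: measurable_funM.
have mPfb z : measurable_fun [set: R] (fun t => P t * f t * box (t - z)).
  by apply: measurable_funM => //; exact: measurable_box_shift.
have fb0 z t : 0 <= f t * box (t - z) by rewrite mulr_ge0 ?box_ge0.
have Pfb0 z t : 0 <= P t * f t * box (t - z) by rewrite !mulr_ge0 ?box_ge0.
have finP z : (\int[mu]_t (P t * f t * box (t - z))%:E)%E \is a fin_num.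
  apply: (fin_num_integral_box (M := (1 + k' * (`|z - x| + 1) ^+ 2) * f 0)).
  - by move=> t; rewrite mulr_ge0.
  - move=> t tz; apply: ler_pM => //; last exact: decay_le0 df.
    have : (t - x) ^+ 2 <= (`|z - x| + 1) ^+ 2.
      rewrite -(real_normK (num_real (t - x))) lerXn2r ?nnegrE ?addr_ge0//.
      rewrite (_ : t - x = (z - x) + (t - z)); last by ring.
      by apply: le_trans (ler_normD _ _) _; rewrite lerD2l.
    by rewrite /P; have := k'0; nra.
  - exact: mPf.
set c := 2 * k' * h * (x - 1).
have c0 : 0 <= c by rewrite !mulr_ge0// subr_ge0.
(* The factors [1 - (t - x)^2] and [box (t - x) - box (t - (x + h))] are both nonnegative inside the
   window around [x] and both nonpositive outside. *)
have E1 : (\int[mu]_t (f t * box (t - (x + h)))%:E +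
           \int[mu]_t (P t * f t * box (t - x))%:E <=
           \int[mu]_t (f t * box (t - x))%:E +
           \int[mu]_t (P t * f t * box (t - (x + h)))%:E)%E.
  apply: le_integralD2 => // t; rewrite -subr_ge0.
  have -> : f t * box (t - x) + P t * f t * box (t - (x + h)) -
      (f t * box (t - (x + h)) + P t * f t * box (t - x)) =
      f t * (k' * ((1 - (t - x) ^+ 2) * (box (t - x) - box (t - (x + h))))).
    by rewrite /P; ring.
  apply: mulr_ge0 => //; apply: mulr_ge0 => //.
  rewrite {1}/box; case: (boolP (`|t - x| <= 1)) => tx.
    apply: mulr_ge0; last by rewrite subr_ge0 /box lern1 leq_b1.
    by rewrite subr_ge0 -(real_normK (num_real (t - x))) expr_le1.
  apply: mulr_le0; last by rewrite sub0r oppr_le0 box_ge0.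
  by rewrite subr_le0 -(real_normK (num_real (t - x))) expr_ge1// ltW// ltNge.
(* Shifting the far window back by [h] puts all integrals on the window around [x]. There [t >= 0]
   since [1 <= x], and [decay_le] compares [t] with [t + h] pointwise. *)
have E2 : (\int[mu]_t (P t * f t * box (t - (x + h)))%:E +
           c%:E * \int[mu]_t (f t * box (t - (x + h)))%:E <=
           \int[mu]_t (P t * f t * box (t - x))%:E)%E.
  rewrite -(@ge0_integral_shift R h (fun t => (P t * f t * _)%:E))//; last 2 first.
  - by apply/measurable_EFinP.
  - by move=> t; rewrite lee_fin.
  rewrite -(@ge0_integral_shift R h (fun t => (f t * _)%:E))//; last 2 first.
  - by apply/measurable_EFinP.
  - by move=> t; rewrite lee_fin.
  rewrite -(@ge0_integralZl_EFin _ (measurableTypeR R))//; last 2 first.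
  - by move=> t _; rewrite lee_fin.
  - apply/measurable_EFinP; apply: (measurableT_comp (mfb (x + h))).
    exact: measurable_funD.
  rewrite -[leRHS]adde0 -(@integral0 _ (measurableTypeR R) R mu setT).
  apply: (@le_integralD2 _ (fun t => c * (f (t + h) * box (t + h - (x + h))))
     _ (fun=> 0)) => //.
  - by move=> t; rewrite mulr_ge0.
  - apply: (measurableT_comp (mPfb (x + h))); exact: measurable_funD.
  - apply: measurable_funM => //; apply: (measurableT_comp (mfb (x + h))).
    exact: measurable_funD.
  move=> t; rewrite addr0 (_ : t + h - (x + h) = t - x); last by ring.
  rewrite mulrA -mulrDl {1 2}/box; case: (boolP (`|t - x| <= 1)); last by rewrite !mulr0.
  rewrite !mulr1 ler_norml => /andP[tx1 tx2].
  have t0 : 0 <= t by lra.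
  have th : t <= t + h by lra.
  have := ler_wpM2l (P0 t) (decay_le df t0 th); apply: le_trans.
  rewrite (_ : P (t + h) * f (t + h) + c * f (t + h) =
    f (t + h) * (P (t + h) + c)); last by ring.
  rewrite mulrCA; apply: ler_wpM2l => //.
  rewrite mulrDr mulr1 mulrA.
  have D0 := le_excess2 th; set D := _ - _.
  apply: (@le_trans _ _ (P t + k' * D)); last first.
    rewrite lerD2l ler_wpM2r ?subr_ge0// {1}k'k ler_wpM2r// /P.
    by have := mulr_ge0 k'0 (sqr_ge0 (t - x)); lra.
  (* The last term is [k' * ((t + h - 1)^2 - (t - 1)^2)]; passing from these squares to squared
     excesses can only increase the difference. *)
  rewrite /c /P (_ : 1 - k' * (1 - (t + h - x) ^+ 2) + 2 * k' * h * (x - 1) =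
   1 - k' * (1 - (t - x) ^+ 2) + k' * (h * (2 * (t - 1) + h))); last by ring.
  rewrite lerD2l; apply: ler_wpM2l => //; rewrite /D /excess.
  by case: (lerP (t - 1) 0) => ?; case: (lerP (t + h - 1) 0) => ?; nra.
(* The integrals weighted by [P] are finite, so they cancel when [E1] and [E2] are added. *)
move: E1 E2; have := finP x; have := finP (x + h).
move: (integral _ _ _) => -[b| |]// _; move: (integral _ _ _) => -[d| |]// _.
rewrite -!conv_boxE -EFinM -!EFinD !lee_fin; lra.
Qed.

(** The step is iterated [n + 1] times with [h = (y - x) / (n + 1)]. The sum of the terms
    [2 h (x_j - 1)] is a Riemann sum that falls short of [(y - 1)^2 - (x - 1)^2] by
    [(y - x)^2 / (n + 1)]; then [n] tends to infinity. *)
Lemma decay_conv_box_step : decay k' (conv_box f).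
Proof.
have step1 x y : 1 <= x -> x <= y ->
    conv_box f y * (1 + k' * ((y - 1) ^+ 2 - (x - 1) ^+ 2)) <= conv_box f x.
  move=> x1 xy.
  have main n : conv_box f y * (1 + k' * ((y - 1) ^+ 2 - (x - 1) ^+ 2
      - (y - x) ^+ 2 / n.+1%:R)) <= conv_box f x.
    pose h := (y - x) / n.+1%:R.
    have h0 : 0 <= h by rewrite divr_ge0// subr_ge0.
    have ind j : conv_box f (x + j%:R * h) *
      (1 + k' * ((x + j%:R * h - 1) ^+ 2 - (x - 1) ^+ 2 - h * (j%:R * h))) <= conv_box f x.
      elim: j => [|j IH].
        by rewrite mul0r addr0 subrr mulr0 subr0 mulr0 addr0 mulr1.
      apply: le_trans IH.
      set z := j%:R * h.
      have z0 : 0 <= z by rewrite mulr_ge0.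
      (* Either [z = 0] or [h <= z]. This gives [1 <= B], and then [A = B + C <= (1 + C) * B]. *)
      have hz : 0 <= z * (z - h).
        rewrite /z; case: (j) => [|j']; first by rewrite !mul0r.
        apply: mulr_ge0; first by rewrite mulr_ge0.
        by rewrite subr_ge0 ler_peMl// ler1n.
      have xz : 1 <= x + z by lra.
      have := conv_box_step xz h0.
      rewrite (_ : x + z + h = x + j.+1%:R * h); last by rewrite -natr1 /z; ring.
      rewrite (_ : j.+1%:R * h = z + h); last by rewrite -natr1 /z; ring.
      set A := 1 + k' * _; set B := 1 + k' * _.
      have B1 : 1 <= B.
        rewrite /B lerDl mulr_ge0//.
        have -> : (x + z - 1) ^+ 2 - (x - 1) ^+ 2 - h * z =
          z * (z - h) + 2 * z * (x - 1) by ring.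
        by rewrite addr_ge0// !mulr_ge0// subr_ge0.
      move=> /(ler_wpM2r (le_trans ler01 B1)); apply: le_trans.
      rewrite -[leRHS]mulrA; apply: ler_wpM2l; first exact: conv_box_ge0.
      set C := 2 * k' * h * (x + z - 1).
      have C0 : 0 <= C by rewrite !mulr_ge0// subr_ge0.
      have -> : A = B + C by rewrite /A /B /C; ring.
      by nra.
    have := ind n.+1; rewrite /h.
    have n0 : (n.+1%:R : R) != 0 by rewrite pnatr_eq0.
    rewrite (_ : n.+1%:R * ((y - x) / n.+1%:R) = y - x); last by field; rewrite addrC natr1.
    rewrite (_ : x + (y - x) = y); last by ring.
    rewrite (_ : (y - x) / n.+1%:R * (y - x) = (y - x) ^+ 2 / n.+1%:R)//.
    by field; rewrite addrC natr1.
  set A := _ - _ in main *.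
  apply/ler_addgt0Pr => e e0.
  pose B := conv_box f y * (k' * (y - x) ^+ 2).
  have B0 : 0 <= B by rewrite mulr_ge0 ?conv_box_ge0// mulr_ge0// sqr_ge0.
  pose n := Num.truncn (B / e).
  have Bn : B / n.+1%:R <= e.
    rewrite ler_pdivrMr// mulrC -ler_pdivrMr//.
    by apply/ltW; rewrite truncnS_gt.
  have := main n; rewrite (_ : conv_box f y * (1 + k' * (A - (y - x) ^+ 2 / n.+1%:R)) =
    conv_box f y * (1 + k' * A) - B / n.+1%:R); last first.
    by rewrite /B; field; rewrite addrC natr1 pnatr_eq0.
  by rewrite lerBlDr => /le_trans; apply; rewrite lerD2l.
split; [exact: conv_box_ge0|exact: conv_boxN|move=> x y x0 xy].
(* Below 1 the excess vanishes and only monotonicity remains; a pair with [x < 1 <= y] is compared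
   through 1. *)
have [x1|x1] := leP 1 x.
  by rewrite !excessE// ?(le_trans x1)//; exact: step1.
rewrite (excess0 (ltW x1)) expr0n/= subr0.
have [y1|y1] := leP 1 y.
  rewrite excessE//; apply: le_trans (conv_box_noninc x0 (ltW x1)).
  by have := step1 _ _ (lexx _) y1; rewrite subrr expr0n/= subr0.
rewrite (excess0 (ltW y1)) expr0n/= mulr0 addr0 mulr1.
exact: conv_box_noninc.
Qed.

End Step.

Lemma decay_conv_box : decay (k / (1 + k)) (conv_box f).
Proof.
have k1 : 0 < 1 + k by rewrite ltr_pwDl.
apply: decay_conv_box_step.
- by rewrite divr_ge0// ltW.
- by rewrite ler_pdivrMr// mul1r lerDr.
- by field; rewrite gt_eqF.
Qed.

End FixedDecay.
End Convolution.

(** * Tail bound for decaying densities *)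

Section Tail.
Context {R : realType}.
Implicit Types (f : R -> R) (k t M : R).

Local Notation mu := (@lebesgue_measure R).

Lemma measurable_gtb M : measurable_fun [set: R] (fun t => (M < t)%R%:R : R).
Proof.
rewrite (_ : (fun t => _) = \1_(`]M, +oo[%classic)); last first.
  by apply/funext => t; rewrite indicE mem_setE in_itv/= andbT.
by apply: measurable_indic; exact: measurable_itv.
Qed.

Lemma measurable_ltb M : measurable_fun [set: R] (fun t => (t < M)%R%:R : R).
Proof.
rewrite (_ : (fun t => _) = \1_(`]-oo, M[%classic)); last first.
  by apply/funext => t; rewrite indicE mem_setE in_itv/=.
by apply: measurable_indic; exact: measurable_itv.
Qed.

(** The squared excess is convex and vanishes at 0, hence is superadditive on nonnegative
    arguments. *)
Lemma excess_shift M t : 0 <= M -> 0 <= t ->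
  excess M ^+ 2 <= excess (t + M) ^+ 2 - excess t ^+ 2.
Proof.
move=> M0 t0; rewrite /excess.
by case: (lerP (M - 1) 0) => ?; case: (lerP (t + M - 1) 0) => ?;
  case: (lerP (t - 1) 0) => ?; nra.
Qed.

(* Shifting the two tails to the origin gives a function dominated by [f]. *)
Lemma decay_tail k f M : 0 <= k -> decay k f -> 0 <= M ->
  ((1 + k * excess M ^+ 2)%:E * \int[mu]_t (f t * (M < `|t|)%R%:R)%:E <=
   \int[mu]_t (f t)%:E)%E.
Proof.
move=> k0 df M0; have f0 := decay_ge0 df; have mf := measurable_decay k0 df.
set r := 1 + _.
have r0 : 0 <= r by rewrite addr_ge0// mulr_ge0// sqr_ge0.
pose u t := r * (f t * (M < t)%R%:R); pose v t := r * (f t * (t < - M)%R%:R).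
have mu_ : measurable_fun [set: R] u.
  by do 2! apply: measurable_funM => //; exact: measurable_gtb.
have mv_ : measurable_fun [set: R] v.
  by do 2! apply: measurable_funM => //; exact: measurable_ltb.
have u0 t : 0 <= u t by rewrite !mulr_ge0.
have v0 t : 0 <= v t by rewrite !mulr_ge0.
have mtail : measurable_fun [set: R] (fun t => f t * (M < `|t|)%R%:R).
  apply: measurable_funM => //.
  exact: measurableT_comp (measurable_gtb M) (@normr_measurable R setT).
rewrite -(@ge0_integralZl_EFin _ (measurableTypeR R))//; last 2 first.
- by move=> t _; rewrite lee_fin mulr_ge0.
- exact/measurable_EFinP.
have -> : (\int[mu]_t (r%:E * (f t * (M < `|t|)%R%:R)%:E) =
    \int[mu]_t ((u t)%:E + (v t)%:E))%E.
  apply: eq_integral => t _; rewrite -EFinM -EFinD /u /v -mulrDr -mulrDr.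
  congr (_ * (_ * _))%:E; rewrite lter_normr.
  have -> : (M < - t) = (t < - M) by apply/idP/idP; lra.
  case: (ltP M t) => h; last by rewrite add0r.
  have -> : (t < - M) = false by apply/negbTE; rewrite -leNgt; lra.
  by rewrite addr0.
rewrite (@ge0_integralD _ (measurableTypeR R))//; try by
  [move=> t _; rewrite lee_fin|exact/measurable_EFinP].
rewrite -(@ge0_integral_shift R M (fun t => (u t)%:E))//; last exact/measurable_EFinP.
rewrite -(@ge0_integral_shift R (- M) (fun t => (v t)%:E))//; last exact/measurable_EFinP.
rewrite -[leRHS]adde0 -(@integral0 _ (measurableTypeR R) R mu setT).
apply: (@le_integralD2 _ (fun t => u (t + M)) (fun t => v (t - M)) _ (fun=> 0)) => //.
- by apply: (measurableT_comp mu_); exact: measurable_funD.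
- by apply: (measurableT_comp mv_); exact: measurable_funB.
have key s : 0 <= s -> r * f (s + M) <= f s.
  move=> s0; have sM : s <= s + M by rewrite lerDl.
  apply: le_trans (decay_le df s0 sM).
  by rewrite mulrC ler_wpM2l// lerD2l ler_wpM2l// excess_shift.
move=> t; rewrite addr0 /u /v.
rewrite (_ : (M < t + M) = (0 < t)); last by rewrite ltrDr.
rewrite (_ : (t - M < - M) = (t < 0)); last by rewrite gtrDr.
case: (ltgtP t 0) => t0; rewrite ?mulr1 ?mulr0 ?add0r ?addr0//.
- have := key (- t); rewrite (decay_even df) oppr_ge0 => /(_ (ltW t0)).
  by rewrite (_ : - t + M = - (t - M)) ?(decay_even df)//; ring.
- exact/key/ltW.
Qed.

End Tail.

(** * Iterated integrals over the coordinates *)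

Section IteratedIntegral.
Context {R : realType} {V : eqType}.
Implicit Types (phi : V -> R) (F : (V -> R) -> \bar R) (v w : V) (s : seq V).

Local Notation mu := (@lebesgue_measure R).
Local Open Scope ereal_scope.

Definition upd phi v (x : R) : V -> R := fun u => if u == v then x else phi u.

(* Measurability in finitely many coordinates at a time, without a
   sigma-algebra on [V -> R]. *)
Definition coord_measurable F : Prop :=
  forall (d : measure_display) (T : measurableType d) (Phi : T -> V -> R),
    (forall v, measurable_fun [set: T] (fun t => Phi t v)) ->
    measurable_fun [set: T] (fun t => F (Phi t)).

Definition integ v F : (V -> R) -> \bar R :=
  fun phi => \int[mu]_x F (upd phi v x).

(** The head of the list is the outermost variable, as in [lebesgue_tuple]. *)
Definition integs F s : (V -> R) -> \bar R := foldr integ F s.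

Lemma updC phi v w x y : v != w ->
  upd (upd phi v x) w y = upd (upd phi w y) v x.
Proof.
move=> vw; apply/funext => u; rewrite /upd.
by have [->|//] := eqVneq u w; rewrite eq_sym (negbTE vw).
Qed.

Lemma measurable_upd d (T : measurableType d) (Phi : T -> V -> R) (g : T -> R) v :
  (forall u, measurable_fun [set: T] (fun t => Phi t u)) ->
  measurable_fun [set: T] g ->
  forall u, measurable_fun [set: T] (fun t => upd (Phi t) v (g t) u).
Proof. by move=> mPhi mg u; rewrite /upd; case: eqP. Qed.

Lemma integ_ge0 F v : (forall phi, 0 <= F phi) -> forall phi, 0 <= integ v F phi.
Proof. by move=> F0 phi; apply: integral_ge0. Qed.

Lemma measurable_integ F v : (forall phi, 0 <= F phi) -> coord_measurable F ->
  coord_measurable (integ v F).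
Proof.
move=> F0 mF d T Phi mPhi.
pose G (p : T * measurableTypeR R) := F (upd (Phi p.1) v p.2).
apply: (@measurable_fun_fubini_tonelli_F _ _ T (measurableTypeR R) R mu G); last first.
  by move=> p; exact: F0.
apply: mF; apply: measurable_upd => [u|]; last exact: measurable_snd.
exact: (measurableT_comp (mPhi u) measurable_fst).
Qed.

Lemma integC F v w : (forall phi, 0 <= F phi) -> coord_measurable F ->
  integ v (integ w F) = integ w (integ v F).
Proof.
move=> F0 mF; have [->//|vw] := eqVneq v w.
apply/funext => phi; rewrite /integ.
pose G (p : measurableTypeR R * measurableTypeR R) := F (upd (upd phi v p.1) w p.2).
rewrite (@fubini_tonelli _ _ (measurableTypeR R) (measurableTypeR R) R mu mu G); last 2 first.
- apply: mF; apply: measurable_upd; last exact: measurable_snd.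
  apply: measurable_upd; last exact: measurable_fst.
  by move=> u; exact: measurable_cst.
- by move=> p; exact: F0.
apply: eq_integral => y _; apply: eq_integral => x _.
by rewrite /G/= updC.
Qed.

Lemma integs_ge0 F s : (forall phi, 0 <= F phi) -> forall phi, 0 <= integs F s phi.
Proof. by move=> F0; elim: s => //= v s IH; exact: integ_ge0. Qed.

Lemma measurable_integs F s : (forall phi, 0 <= F phi) -> coord_measurable F ->
  coord_measurable (integs F s).
Proof.
move=> F0 mF; elim: s => //= v s IH.
by apply: measurable_integ => //; exact: integs_ge0.
Qed.

Lemma integs_cat F s1 s2 : integs F (s1 ++ s2) = integs (integs F s2) s1.
Proof. exact: foldr_cat. Qed.

Lemma integs_mid F v s1 s2 : (forall phi, 0 <= F phi) -> coord_measurable F ->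
  integs F (s1 ++ v :: s2) = integs F (v :: s1 ++ s2).
Proof.
move=> F0 mF; elim: s1 => //= w s1 ->; rewrite /= integC//.
  exact: integs_ge0.
exact: measurable_integs.
Qed.

Lemma perm_integs F s1 s2 : (forall phi, 0 <= F phi) -> coord_measurable F ->
  perm_eq s1 s2 -> integs F s1 = integs F s2.
Proof.
move=> F0 mF; elim: s1 s2 => [|v s1 IH] s2.
  by move/perm_size/esym/size0nil => ->.
move=> s12; have vs2 : v \in s2 by rewrite -(perm_mem s12) mem_head.
case/splitPr: vs2 s12 => p1 p2; rewrite perm_sym -[v :: p2]cat1s perm_catCA/= perm_cons.
by rewrite perm_sym => /IH E; rewrite integs_mid//= E.
Qed.

(** Tonelli brings the head innermost; a leaf at the head of the list is eliminated first in this
    way. *)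
Lemma integs_behead F v s : (forall phi, 0 <= F phi) -> coord_measurable F ->
  integs F (v :: s) = integs (integ v F) s.
Proof.
move=> F0 mF; rewrite -(@integs_cat F s [:: v]); apply: perm_integs => //.
by rewrite perm_sym perm_catC.
Qed.

(** The background [phi] is arbitrary because the induction below moves the head coordinate into it,
    as [upd phi v x]. *)
Definition fill s n (t : n.-tuple R) phi : V -> R :=
  fun u => if u \in s then nth 0%R t (index u s) else phi u.

Lemma lebesgue_tuple_integs s n (A : set (V -> R)) phi : size s = n -> uniq s ->
  lebesgue_tuple [set t : n.-tuple R | A (fill s t phi)] =
  integs (fun psi => (\1_A psi)%:E) s phi.
Proof.
elim: s n phi => [|v s IH] [|n] phi //=.
move=> [sn] /andP[vs us]; rewrite /integ; apply: eq_integral => x _.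
rewrite -(IH n)//; congr lebesgue_tuple; apply/seteqP.
have E (t : n.-tuple R) : fill (v :: s) [tuple of x :: t] phi = fill s t (upd phi v x).
  apply/funext => u; rewrite /fill /upd inE/= (eq_sym v u).
  by case: (eqVneq u v) => [uv|//]; rewrite uv (negbTE vs).
by split=> t /=; rewrite E.
Qed.

End IteratedIntegral.

(** * Integrating out leaves *)

Section Peeling.
Context {R : realType} {V : choiceType}.
Variables (e : rel V) (r : V).
Hypotheses (e_sym : symmetric e) (e_irr : irreflexive e).
Implicit Types (phi h : V -> R) (a : V -> R -> R) (b : R -> R) (u v w l : V)
  (s : seq V).

Local Notation mu := (@lebesgue_measure R).

Definition edge_box u v (x : R) : R := if e u v then box x else 1.

(** The double product meets each edge in both orientations, which is harmless since [box] takes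
    only the values 0 and 1. *)
Definition weight a s phi : R :=
  (\prod_(v <- s) a v (phi v)) *
  \prod_(u <- s) \prod_(v <- s) edge_box u v (phi u - phi v).

(** An elimination order ending at [r]: the head is a leaf, attached to [w], of the graph induced on
    the list. *)
Inductive peeling : seq V -> Prop :=
| PeelingRoot : peeling [:: r]
| PeelingLeaf l w s : peeling s -> l \notin s -> w \in s -> e l w ->
    (forall v, v \in s -> e l v -> v = w) -> peeling (l :: s).

Lemma peeling_root s : peeling s -> r \in s.
Proof.
by elim=> [|l w {}s _ IH _ _ _ _]; rewrite inE ?eqxx// IH orbT.
Qed.

Lemma peeling_uniq s : peeling s -> uniq s.
Proof. by elim=> [//|l w {}s _ IH ls _ _ _]; rewrite /= ls. Qed.

Lemma edge_box_ge0 u v x : 0 <= edge_box u v x.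
Proof. by rewrite /edge_box; case: ifP => // _; exact: box_ge0. Qed.

Lemma edge_boxN u v x : edge_box v u (- x) = edge_box u v x.
Proof. by rewrite /edge_box e_sym; case: ifP => // _; rewrite boxN. Qed.

Lemma measurable_edge_box u v : measurable_fun [set: R] (edge_box u v).
Proof. by rewrite /edge_box; case: (e u v) => //; exact: measurable_box. Qed.

Lemma weight_ge0 a s phi : (forall v, v \in s -> forall x, 0 <= a v x) ->
  0 <= weight a s phi.
Proof.
move=> a0; rewrite mulr_ge0//.
  by rewrite big_seq; apply: prodr_ge0 => v vs; exact: a0.
by apply: prodr_ge0 => u _; apply: prodr_ge0 => v _; exact: edge_box_ge0.
Qed.

Lemma coord_measurable_weight a b s :
  (forall v, v \in s -> measurable_fun [set: R] (a v)) ->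
  measurable_fun [set: R] b ->
  coord_measurable (fun phi => (weight a s phi * b (phi r))%:E).
Proof.
move=> ma mb d T Phi mPhi; apply/measurable_EFinP; apply: measurable_funM.
  apply: measurable_funM.
    by apply: measurable_prod => v vs; exact: measurableT_comp (ma _ vs) (mPhi v).
  apply: measurable_prod => u _; apply: measurable_prod => v _.
  apply: (measurableT_comp (measurable_edge_box u v)).
  exact: measurable_funB.
exact: measurableT_comp mb (mPhi r).
Qed.

Lemma weight_leaf a l w s phi (x : R) : uniq s -> l \notin s -> w \in s -> e l w ->
  (forall v, v \in s -> e l v -> v = w) ->
  weight a (l :: s) (upd phi l x) = weight a s phi * (a l x * box (x - phi w)).
Proof.
move=> us ls ws lw lwP.
have updl : upd phi l x l = x by rewrite /upd eqxx.
have updE v : v \in s -> upd phi l x v = phi v.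
  by move=> vs; rewrite /upd; case: eqP => // vl; rewrite -vl vs in ls.
have boxE : \prod_(v <- s) edge_box l v (x - phi v) = box (x - phi w).
  rewrite (bigD1_seq w)//= /edge_box lw big1_seq ?mulr1// => v /andP[vw vs].
  by case: ifP => // /(lwP _ vs) E; rewrite E eqxx in vw.
have aE : \prod_(v <- s) a v (upd phi l x v) = \prod_(v <- s) a v (phi v).
  by apply: eq_big_seq => v /updE ->.
have rowE : \prod_(v <- s) edge_box l v (x - upd phi l x v) = box (x - phi w).
  by rewrite -boxE; apply: eq_big_seq => v /updE ->.
have colE : \prod_(u <- s) edge_box u l (upd phi l x u - x) = box (x - phi w).
  by rewrite -boxE; apply: eq_big_seq => v /updE ->; rewrite -edge_boxN opprB.
have restE : \prod_(u <- s) \prod_(v <- s) edge_box u v (upd phi l x u - upd phi l x v) =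
    \prod_(u <- s) \prod_(v <- s) edge_box u v (phi u - phi v).
  by apply: eq_big_seq => u us'; apply: eq_big_seq => v vs; rewrite !updE.
have rowsE : \prod_(u <- s) \prod_(v <- l :: s) edge_box u v (upd phi l x u - upd phi l x v) =
    box (x - phi w) * \prod_(u <- s) \prod_(v <- s) edge_box u v (phi u - phi v).
  by rewrite -colE -restE -big_split/=; apply: eq_bigr => u _; rewrite big_cons updl.
have diagE y : edge_box l l y = 1 by rewrite /edge_box e_irr.
have boxbox : box (x - phi w) * box (x - phi w) = box (x - phi w).
  by rewrite /box; case: (_ <= 1); rewrite ?mulr1 ?mulr0.
rewrite /weight big_cons big_cons rowsE big_cons updl aE rowE diagE -[in RHS]boxbox; ring.
Qed.

Definition absorb a l w v : R -> R :=
  if v == w then fun x => a w x * conv_box (a l) x else a v.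

Lemma weight_absorb a l w s phi : uniq s -> w \in s ->
  weight (absorb a l w) s phi = weight a s phi * conv_box (a l) (phi w).
Proof.
move=> us ws; rewrite /weight mulrAC; congr (_ * _).
rewrite !(bigD1_seq w)//= {1}/absorb eqxx mulrAC; congr (_ * _ * _).
by apply: eq_bigr => v vw; rewrite /absorb (negbTE vw).
Qed.

Lemma integ_leaf (k : R) a b l w s : 0 <= k -> decay k (a l) ->
  (forall v, v \in s -> forall x, 0 <= a v x) -> (forall x, 0 <= b x) ->
  uniq s -> r \in s -> l \notin s -> w \in s -> e l w ->
  (forall v, v \in s -> e l v -> v = w) ->
  integ l (fun phi => (weight a (l :: s) phi * b (phi r))%:E) =
  (fun phi => (weight (absorb a l w) s phi * b (phi r))%:E).
Proof.
move=> k0 dl a0 b0 us rs ls ws lw lwP; apply/funext => phi.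
rewrite /integ weight_absorb//.
have rl : (r == l) = false by apply/negbTE; apply: contraNneq ls => <-.
have al0 := decay_ge0 dl.
under eq_integral => x _.
  rewrite (@weight_leaf _ _ w)// /upd rl mulrAC EFinM.
  over.
rewrite (@ge0_integralZl_EFin _ (measurableTypeR R))//.
- by rewrite -(conv_boxE k0)// -EFinM mulrAC.
- by move=> x _; rewrite lee_fin mulr_ge0 ?box_ge0.
- apply/measurable_EFinP; apply: measurable_funM; last exact: measurable_box_shift.
  exact: measurable_decay dl.
- by rewrite mulr_ge0// weight_ge0.
Qed.

(** * Decay rates from superharmonic voltages *)

Section Conductance.
Variables (nbr : V -> seq V) (h : V -> R).
Hypotheses (nbr_uniq : forall v, uniq (nbr v))
  (mem_nbr : forall v c, (c \in nbr v) = e v c).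
Hypotheses (h_gt0 : forall v, 0 < h v)
  (h_sup : forall v, v != r -> 0 <= \sum_(c <- nbr v) (h v - h c)).

(** The current from [v] to [c] through a unit resistor, per unit of voltage at [v], with negative
    currents replaced by 0. *)
Definition drop_to v c : R := Num.max (1 - h c / h v) 0.

(* Lower bound for the conductance from [v] through the vertices outside [s],
   read off the voltages [h]. *)
Definition outflow v s : R := \sum_(c <- nbr v | c \notin s) drop_to v c.

Lemma drop_to_ge0 v c : 0 <= drop_to v c.
Proof. by rewrite /drop_to le_max lexx orbT. Qed.

Lemma outflow_ge0 v s : 0 <= outflow v s.
Proof. by apply: sumr_ge0 => c _; exact: drop_to_ge0. Qed.

(* The series law for a unit resistor, as an inequality between voltages. *)
Lemma drop_to_series l w s : l != r -> l \notin s -> w \in s -> e l w ->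
  (forall v, v \in s -> e l v -> v = w) ->
  drop_to w l <= outflow l (l :: s) / (1 + outflow l (l :: s)).
Proof.
move=> lr ls ws lw lwP; set k := outflow _ _.
have k0 : 0 <= k := outflow_ge0 _ _.
have k1 : 0 < 1 + k by rewrite ltr_pwDl.
rewrite /drop_to ge_max; apply/andP; split; last by rewrite divr_ge0// ltW.
have hw := h_gt0 w; have hl := h_gt0 l.
suff : h w <= (1 + k) * h l.
  move=> hwl; rewrite lerBlDr -lerBlDl.
  rewrite (_ : 1 - k / (1 + k) = (1 + k)^-1); last by field; rewrite gt_eqF.
  by rewrite ler_pdivlMr// mulrC ler_pdivrMr// mulrC.
have := h_sup lr; rewrite (bigD1_seq w) ?mem_nbr//=.
have : \sum_(c <- nbr l | c != w) (h l - h c) <= k * h l.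
  rewrite /k /outflow mulr_suml big_seq_cond [leRHS]big_seq_cond.
  rewrite (eq_bigl (fun c => (c \in nbr l) && (c \notin l :: s))); last first.
    move=> c; rewrite mem_nbr; case: (boolP (e l c)) => //= lc.
    rewrite inE negb_or; have -> /= : c != l by apply: contraTneq lc => ->; rewrite e_irr.
    by congr negb; apply/eqP/idP => [->//|cs]; exact: lwP.
  apply: ler_sum => c _.
  apply: (@le_trans _ _ ((1 - h c / h l) * h l)).
    by rewrite mulrBl mul1r divfK// gt_eqF.
  by rewrite ler_pM2r// /drop_to le_max lexx.
lra.
Qed.

Lemma outflow_leaf l w s v : l \notin s -> v \in s -> v != w ->
  (forall v, v \in s -> e l v -> v = w) -> outflow v s = outflow v (l :: s).
Proof.
move=> ls vs vw lwP; rewrite /outflow big_seq_cond [RHS]big_seq_cond.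
apply: eq_bigl => c; rewrite mem_nbr; case: (boolP (e v c)) => //= vc.
rewrite inE negb_or; suff -> : c != l by [].
apply: contraNneq vw => cl; apply/eqP; apply: lwP => //.
by rewrite e_sym -cl.
Qed.

Lemma outflow_absorb l w s : l \notin s -> e l w ->
  outflow w s = outflow w (l :: s) + drop_to w l.
Proof.
move=> ls lw; rewrite /outflow big_mkcond (bigD1_seq l)//= ?mem_nbr 1?e_sym//.
rewrite ls addrC -big_mkcondr; congr (_ + _).
by apply: eq_bigl => c; rewrite inE negb_or andbC.
Qed.

(** Induction along the elimination order. Removing [l] raises the outflow of [w] by [drop_to w l];
    by the series law the new factor [conv_box (a l)] decays at least at that rate, and the parallel
    law adds the rates. The function [f] does not depend on [b], so it is a density for the height
    at [r]. *)
Lemma integs_weight s : peeling s ->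
  forall a, (forall v, v \in s -> decay (outflow v s) (a v)) ->
  exists2 f, decay (outflow r [:: r]) f &
  forall b, measurable_fun [set: R] b -> (forall x, 0 <= b x) ->
  integs (fun phi => (weight a s phi * b (phi r))%:E) s (fun=> 0) =
  (\int[mu]_x (f x * b x)%:E)%E.
Proof.
elim=> [|l w {}s ps IH ls ws lw lwP] a da.
  exists (a r); first by apply: da; rewrite inE.
  move=> b mb b0; rewrite /= /integ; apply: eq_integral => x _.
  by rewrite /weight !big_seq1 /upd eqxx /edge_box e_irr mulr1.
have us := peeling_uniq ps; have rs := peeling_root ps.
have lr : l != r by apply: contraNneq ls => ->.
have dl : decay (outflow l (l :: s)) (a l) by apply: da; rewrite mem_head.
have das v : v \in s -> decay (outflow v (l :: s)) (a v).
  by move=> vs; apply: da; rewrite inE vs orbT.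
have da' v : v \in s -> decay (outflow v s) (absorb a l w v).
  move=> vs; rewrite /absorb; case: (eqVneq v w) => [->|vw]; last first.
    by rewrite (@outflow_leaf l w)//; exact: das.
  rewrite (outflow_absorb ls lw); apply: decayM.
  - exact: outflow_ge0.
  - exact: drop_to_ge0.
  - exact: das.
  - apply: (decayW (drop_to_ge0 _ _) (drop_to_series lr ls ws lw lwP)).
    exact: decay_conv_box (outflow_ge0 _ _) dl.
have [f df fE] := IH _ da'; exists f => // b mb b0.
have a0 v : v \in l :: s -> forall x, 0 <= a v x by move=> /da /decay_ge0.
have aW phi : (0 <= (weight a (l :: s) phi * b (phi r))%:E)%E.
  by rewrite lee_fin mulr_ge0// weight_ge0.
rewrite integs_behead//; last first.
  apply: coord_measurable_weight => // v vs.
  exact: measurable_decay (outflow_ge0 _ _) (da _ vs).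
rewrite (integ_leaf (outflow_ge0 l (l :: s)) dl _ b0 us rs ls ws lw lwP) ?fE//.
by move=> v vs; apply: a0; rewrite inE vs orbT.
Qed.

End Conductance.
End Peeling.

(** * Elimination orders of finite connected sets *)

Section Exhaustion.
Context {V : choiceType}.
Variables (e : rel V) (r : V).
Hypotheses (e_sym : symmetric e) (e_acyclic : acyclic e).
Implicit Types (u v w l x y : V) (s p : seq V).

Lemma peeling_connected s : peeling e r s -> connected_on e [set` s].
Proof.
elim=> [|l w {}s _ IH ls ws lw lwP] x y /=.
  by rewrite !inE => /eqP-> /eqP->; exists [::].
rewrite !inE => /orP[/eqP->|xs] /orP[/eqP->|ys].
- by exists [::].
- have [p [wp py ps]] := IH w y ws ys; exists (w :: p); split => //=.
    by rewrite lw.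
  move=> z; rewrite !inE => /orP[/eqP->|/ps zs]; first by rewrite ws orbT.
  by rewrite [_ \in s]zs orbT.
- have [p [xp pw ps]] := IH x w xs ws; exists (rcons p l); split.
  + by rewrite rcons_path xp pw e_sym.
  + by rewrite last_rcons.
  + move=> z; rewrite mem_rcons !inE => /orP[->//|/ps zs].
    by rewrite [_ \in s]zs orbT.
- have [p [xp py ps]] := IH x y xs ys; exists p; split => // z /ps zs.
  by rewrite inE [_ \in s]zs orbT.
Qed.

(** Two distinct neighbours of [l] in [s], joined by a simple path inside the connected set [s],
    would close a cycle through [l]. *)
Lemma peeling_nbr_unique s l u v : peeling e r s -> l \notin s ->
  u \in s -> v \in s -> e l u -> e l v -> u = v.
Proof.
move=> ps ls us vs lu lv; have [p [up pv pS]] := peeling_connected ps us vs.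
have [//|uv] := eqVneq u v.
case/shortenP: up pv => q uq qu qp qv.
have qS z : z \in q -> z \in s by by move=> /qp/pS.
have := @e_acyclic (l :: u :: q); rewrite /= ltnS ltnS leqn0.
suff : ucycle e (l :: u :: q).
  by move=> C /(_ C); rewrite size_eq0 => /eqP q0; rewrite -qv q0/= eqxx in uv.
apply/andP; split.
  by rewrite /= lu rcons_path uq/= qv e_sym lv.
rewrite cons_uniq qu andbT inE negb_or; apply/andP; split.
  by apply: contraNneq ls => ->.
by apply: contra ls => /qS.
Qed.

Lemma path_exit (L : {pred V}) s p y : y \in s -> path e y p ->
  last y p \notin s -> (forall z, z \in p -> z \in L) ->
  exists w l, [/\ w \in s, l \notin s, l \in L & e w l].
Proof.
elim: p y => [|z p IH] y ys /=; first by rewrite ys.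
move=> /andP[yz zp] pz pL; have [zs|zs] := boolP (z \in s).
  by apply: (IH z) => // t tp; apply: pL; rewrite inE tp orbT.
by exists y, z; split => //; apply: pL; rewrite mem_head.
Qed.

(** The list grows from the root: as long as a vertex of [L] is missing, a path to it inside [L]
    leaves the list along an edge, whose endpoint outside is the next leaf. *)
Lemma exists_peeling (L : {fset V}) : r \in L -> connected_on e [set` L] ->
  exists2 s, peeling e r s & perm_eq s L.
Proof.
move=> rL cL.
have ext n : (n < #|` L|)%N ->
    exists s, [/\ peeling e r s, size s = n.+1 & {subset s <= L}].
  elim: n => [_|n IH nL].
    exists [:: r]; split => // [|z]; first exact: PeelingRoot.
    by rewrite inE => /eqP->.
  have [s [ps sn sL]] := IH (ltnW nL).
  have [x xL xs] : exists2 x, x \in L & x \notin s.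
    apply: contrapT => nx; suff : {subset L <= s}.
      by move=> /(uniq_leq_size (fset_uniq L)); rewrite sn leqNgt nL.
    by move=> x xL; apply: contra_notT nx => xs; exists x.
  have [p [rp px pL]] := cL r x rL xL.
  have pxs : last r p \notin s by rewrite px.
  have [w [l [ws ls lL wl]]] := @path_exit (mem L) s p r (peeling_root ps) rp pxs pL.
  exists (l :: s); split => /=; [|by rewrite sn|].
    apply: (PeelingLeaf ps ls ws); first by rewrite e_sym.
    move=> v vs lv; apply: (peeling_nbr_unique ps ls vs ws lv).
    by rewrite e_sym.
  by move=> z; rewrite inE => /orP[/eqP->|/sL].
have L0 : (0 < #|` L|)%N by rewrite cardfs_gt0; apply/fset0Pn; exists r.
have /ext[s [ps sn sL]] : (#|` L|.-1 < #|` L|)%N by rewrite prednK.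
exists s => //; apply: uniq_perm; [exact: peeling_uniq ps|exact: fset_uniq|].
have sizeL : (size (enum_fset L) <= size s)%N by rewrite sn prednK.
by have [_] := uniq_min_size (peeling_uniq ps) sL sizeL.
Qed.

End Exhaustion.

(** * Hitting probabilities *)

Section HittingProbability.
Context {R : realType} {V : choiceType}.
Variables (e : rel V) (r : V).
Hypothesis e_fin : locally_finite e.
Implicit Types (u v c : V) (n m : nat).

Definition nbrs v : {fset V} := fset_set [set y | e v y].

Lemma mem_nbrs v c : (c \in nbrs v) = e v c.
Proof. by rewrite in_fset_set ?mem_setE//; exact: e_fin. Qed.

(* Probability that the walk started at [v] visits [r] at one of the times
   1, ..., n. *)
Fixpoint hit n v : R :=
  if n is n'.+1 then
    (degree e v)%:R^-1 * \sum_(c <- nbrs v) (if c == r then 1 else hit n' c)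
  else 0.

Definition hit0 n v : R := if v == r then 1 else hit n v.

Lemma hitS n v : hit n.+1 v = (degree e v)%:R^-1 * \sum_(c <- nbrs v) hit0 n c.
Proof. by []. Qed.

Lemma hit_ge0 n v : 0 <= hit n v.
Proof.
elim: n v => [//|n IH] v; rewrite hitS mulr_ge0 ?invr_ge0//.
by apply: sumr_ge0 => c _; rewrite /hit0; case: ifP.
Qed.

Lemma hit_le1 n v : hit n v <= 1.
Proof.
elim: n v => [|n IH] v; first exact: ler01.
rewrite hitS; have [->|d0] := eqVneq (degree e v) 0; first by rewrite invr0 mul0r.
rewrite ler_pdivrMl ?ltr0n ?lt0n// mulr1.
apply: (@le_trans _ _ (\sum_(c <- nbrs v) 1)).
  by apply: ler_sum => c _; rewrite /hit0; case: ifP.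
by rewrite big_const_seq count_predT iter_addr_0.
Qed.

Lemma hit_ndecr v : {homo hit^~ v : n m / (n <= m)%N >-> n <= m}.
Proof.
apply/nondecreasing_seqP => n; elim: n v => [|n IH] v; first exact: hit_ge0.
rewrite !hitS ler_wpM2l ?invr_ge0//.
by apply: ler_sum => c _; rewrite /hit0; case: ifP.
Qed.

Lemma hit0_le1 n v : hit0 n v <= 1.
Proof. by rewrite /hit0; case: ifP => // _; exact: hit_le1. Qed.

Lemma hit0_ge0 n v : 0 <= hit0 n v.
Proof. by rewrite /hit0; case: ifP => // _; exact: hit_ge0. Qed.

Lemma hit0_ndecr v : {homo hit0^~ v : n m / (n <= m)%N >-> n <= m}.
Proof. by move=> n m nm; rewrite /hit0; case: ifP => // _; exact: hit_ndecr. Qed.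

Definition hit_oo v : R := limn (hit0^~ v).

Lemma cvg_hit0 v : hit0^~ v @ \oo --> hit_oo v.
Proof.
apply: nondecreasing_is_cvgn; first exact: hit0_ndecr.
by exists 1 => _ [n _ <-]; exact: hit0_le1.
Qed.

Lemma hit_oo_ge0 v : 0 <= hit_oo v.
Proof. by apply: limr_ge; [exact: cvg_hit0|apply: nearW => n; exact: hit0_ge0]. Qed.

Lemma hit0_le_oo n v : hit0 n v <= hit_oo v.
Proof. exact: nondecreasing_cvgn_le (@hit0_ndecr v) (@cvg_hit0 v) n. Qed.

Lemma sum_hit_oo_le v (M : R) :
  (forall n, \sum_(c <- nbrs v) hit0 n c <= M) -> \sum_(c <- nbrs v) hit_oo c <= M.
Proof.
move=> sM.
have cv : (fun n => \sum_(c <- nbrs v) hit0 n c) @ \oo --> \sum_(c <- nbrs v) hit_oo c.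
  elim: (enum_fset (nbrs v)) => [|c s IH].
    under eq_fun do rewrite big_nil.
    by rewrite big_nil; exact: cvg_cst.
  under eq_fun do rewrite big_cons.
  by rewrite big_cons; apply: cvgD => //; exact: cvg_hit0.
rewrite -(cvg_lim _ cv)//; apply: limr_le; first by apply/cvg_ex; eexists; exact: cv.
exact: nearW.
Qed.

(** The average of [hit0 n] over the neighbours of [v] is [hit n.+1 v], which is at most [hit_oo v];
    then [n] tends to infinity. *)
Lemma hit_oo_sup v : v != r -> 0 <= \sum_(c <- nbrs v) (hit_oo v - hit_oo c).
Proof.
move=> vr; rewrite sumrB big_const_seq count_predT iter_addr_0 subr_ge0.
apply: sum_hit_oo_le => n.
have [d0|d0] := eqVneq (degree e v) 0.
  have /eqP/nilP s0 := d0; rewrite -[size _]/(degree e v) d0 mulr0n.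
  by rewrite (_ : enum_fset (nbrs v) = [::]) ?big_nil//; exact/nilP.
rewrite -[size _]/(degree e v) -mulr_natl -ler_pdivrMl ?ltr0n ?lt0n//.
by apply: le_trans (hit0_le_oo n.+1 v); rewrite /hit0 (negbTE vr).
Qed.

(** * Comparison of the recursion with the walk *)

Section Walk.
Context {d : measure_display} {Omega : measurableType d}.
Variables (P : probability Omega R) (X : nat -> Omega -> V).
Hypothesis walk : simple_random_walk e P r X.

Definition prefix_set n (x : nat -> V) : set Omega :=
  [set w | forall i, (i <= n)%N -> X i w = x i].

Definition hit_set n m : set Omega :=
  [set w | exists2 i, (n < i <= n + m)%N & X i w = r].

Lemma measurable_prefix_set n x : measurable (prefix_set n x).
Proof.
have -> : prefix_set n x = \bigcap_(i in [set i | (i <= n)%N]) [set w | X i w = x i].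
  by [].
by apply: bigcap_measurableType => i _; have [mX _ _] := walk; exact: mX.
Qed.

Lemma measurable_hit_set n m : measurable (hit_set n m).
Proof.
have -> : hit_set n m = \bigcup_(i in [set i | (n < i <= n + m)%N]) [set w | X i w = r].
  by [].
by apply: bigcup_measurable => i _; have [mX _ _] := walk; exact: mX.
Qed.

Let snoc n (x : nat -> V) c i : V := if i == n.+1 then c else x i.

(* The event on the right is only split over the neighbours of [x n]: as a lower
   bound suffices, that the walk almost surely follows the edges is not needed. *)
Lemma hit_prefix_le m n x :
  (P (prefix_set n x) * (hit m (x n))%:E <= P (prefix_set n x `&` hit_set n m))%E.
Proof.
elim: m n x => [|m IH] n x; first by rewrite mule0 measure_ge0.
(* The walk follows the prefix, moves to [c] and visits [r] by time [n + m + 1], at once if [c = r].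
   These events are disjoint for distinct [c]. *)
pose A c := prefix_set n.+1 (snoc n x c) `&` (if c == r then setT else hit_set n.+1 m).
have mA c : measurable (A c).
  apply: measurableI; first exact: measurable_prefix_set.
  by case: ifP => // _; exact: measurable_hit_set.
have AP c : e (x n) c ->
    (P (prefix_set n x) * ((degree e (x n))%:R^-1 * hit0 m c)%:E <= P (A c))%E.
  move=> xc.
  have [_ _ markov] := walk.
  have step : P (prefix_set n.+1 (snoc n x c)) =
      (P (prefix_set n x) * ((degree e (x n))%:R^-1)%:E)%E.
    rewrite [LHS]markov /snoc eqxx (ltn_eqF (ltnSn n)) /srw_step xc.
    congr (P _ * _)%E; apply/seteqP; split => w /= H i ni; have := H i ni;
      by rewrite (ltn_eqF (_ : i < n.+1)%N).
  rewrite EFinM muleA -step /hit0 /A; case: ifP => _.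
    by rewrite mule1 setIT.
  by have := IH n.+1 (snoc n x c); rewrite {2}/snoc eqxx.
have sub : \big[setU/set0]_(c <- nbrs (x n)) A c `<=` prefix_set n x `&` hit_set n m.+1.
  rewrite -bigcup_seq; apply: bigcup_sub => c _ w [xw hw].
  have xnw i : (i <= n)%N -> X i w = x i.
    by move=> ni; rewrite xw ?leqW// /snoc ltn_eqF.
  split; first exact: xnw.
  move: hw; case: eqP => [cr _|_ [i /andP[ni im] Xr]].
    exists n.+1; first by rewrite ltnSn/= addnS ltnS leq_addr.
    by rewrite xw// /snoc eqxx.
  by exists i => //; rewrite (ltn_trans _ ni)//= addnS -addSn.
have tA : trivIset [set` nbrs (x n)] A.
  apply/trivIsetP => c c' _ _ cc'; apply/seteqP; split => // w [[xw _] [xw' _]].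
  have := xw n.+1 (leqnn _); rewrite xw'// /snoc eqxx => E.
  by rewrite E eqxx in cc'.
apply: (@le_trans _ _ (P (\big[setU/set0]_(c <- nbrs (x n)) A c))); last first.
  apply: le_measure => //; rewrite inE.
    by apply: bigsetU_measurable => c _.
  by apply: measurableI; [exact: measurable_prefix_set|exact: measurable_hit_set].
rewrite measure_fbigsetU//.
have Pfin : P (prefix_set n x) \is a fin_num.
  by apply: fin_num_measure; exact: measurable_prefix_set.
rewrite -(fineK Pfin) -EFinM hitS mulrA mulr_sumr -sumEFin.
rewrite big_seq [leRHS]big_seq; apply: lee_sum => c.
by rewrite mem_nbrs => /AP; rewrite -(fineK Pfin) -EFinM mulrA.
Qed.

Lemma hit_le_return m :
  ((hit m r)%:E <= P [set w | exists2 n, (0 < n)%N & X n w = r])%E.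
Proof.
have [mX X0 _] := walk.
have := hit_prefix_le m 0 (fun=> r).
have -> : prefix_set 0 (fun=> r) = [set w | X 0 w = r].
  by apply/seteqP; split => w /=; [apply|move=> Xr []].
rewrite X0 mul1e => /le_trans; apply; apply: le_measure; rewrite ?inE.
- by apply: measurableI; [exact: mX|exact: measurable_hit_set].
- have -> : [set w | exists2 n, (0 < n)%N & X n w = r] =
    \bigcup_(n in [set n | (0 < n)%N]) [set w | X n w = r] by [].
  by apply: bigcup_measurable => i _; exact: mX.
- by move=> w [_ [i /andP[i0 _] Xr]]; exists i.
Qed.

End Walk.
End HittingProbability.

(** * Tightness *)

Section Assembly.
Context {R : realType} {V : choiceType}.
Variables (e : rel V) (r : V).
Hypotheses (e_tree : is_tree e) (e_fin : locally_finite e).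

Local Notation mu := (@lebesgue_measure R).

Let e_sym : symmetric e. Proof. by case: e_tree. Qed.
Let e_irr : irreflexive e. Proof. by case: e_tree. Qed.
Let e_acyclic : acyclic e. Proof. by case: e_tree. Qed.

(* The constant 1 keeps the voltage positive without any appeal to
   connectedness. *)
Definition voltage v : R := 1 + hit_oo e r v.

Lemma voltage_gt0 v : 0 < voltage v.
Proof. by rewrite ltr_pwDl// hit_oo_ge0. Qed.

Lemma voltage_sup v : v != r -> 0 <= \sum_(c <- nbrs e v) (voltage v - voltage c).
Proof.
move=> vr; rewrite (eq_bigr (fun c => hit_oo e r v - hit_oo e r c)).
  exact: hit_oo_sup.
by move=> c _; rewrite /voltage; ring.
Qed.

(** The voltage at the root is 2, so each neighbour [c] contributes at least [(1 - hit_oo c) / 2].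
    The average of [hit_oo] over the neighbours is at most the return probability [rho], which is
    below 1. *)
Lemma outflow_root_gt0 : infinite_set [set: V] -> transient R e r ->
  0 < outflow (nbrs e) voltage r [:: r].
Proof.
move=> Voo [disp] [T] [P] [X] [walk ret].
set Ret := [set w | _] in ret.
have retfin : P Ret \is a fin_num.
  by rewrite ge0_fin_numE ?measure_ge0// (lt_trans ret)// ltry.
set rho := fine (P Ret).
have rho1 : rho < 1 by rewrite -lte_fin fineK.
have hit_rho m : hit e r m r <= rho.
  by rewrite -lee_fin fineK//; exact: hit_le_return.
(* An infinite connected graph has a vertex besides the root, and the first edge of a path to it
   starts at the root. *)
have deg0 : (0 < degree e r)%N.
  have [y yr] : exists y, y != r.
    apply: contrapT => ny; apply: Voo; apply: (sub_finite_set _ (finite_set1 r)).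
    by move=> y _ /=; apply: contrapT => /eqP yr; apply: ny; exists y.
  have [_ _ cV _] := e_tree; have [[|c p] [rp py _]] := cV r y I I.
    by rewrite -py/= eqxx in yr.
  move: rp => /= /andP[rc _]; rewrite cardfs_gt0; apply/fset0Pn; exists c.
  by rewrite (mem_nbrs e_fin).
have deg0R : 0 < (degree e r)%:R :> R by rewrite ltr0n.
have hit_r : hit_oo e r r = 1 :> R.
  rewrite /hit_oo (_ : (fun n => hit0 e r n r) = (fun=> 1)); first exact: lim_cst.
  by apply/funext => n; rewrite /hit0 eqxx.
have S : \sum_(c <- nbrs e r) hit_oo e r c <= (degree e r)%:R * rho.
  apply: sum_hit_oo_le => n; rewrite -ler_pdivrMl//; exact: (hit_rho n.+1).
apply: (@lt_le_trans _ _ (((degree e r)%:R - \sum_(c <- nbrs e r) hit_oo e r c) / 2)).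
  rewrite divr_gt0// subr_gt0 (le_lt_trans S)// gtr_pMr//.
have -> : (degree e r)%:R = \sum_(c <- nbrs e r) (1 : R).
  by rewrite big_const_seq count_predT iter_addr_0.
rewrite -sumrB mulr_suml /outflow big_seq_cond [leRHS]big_seq_cond.
rewrite [leRHS](eq_bigl (fun c => (c \in nbrs e r) && true)); last first.
  move=> c; rewrite (mem_nbrs e_fin); case: (boolP (e r c)) => //= rc.
  by rewrite inE; apply: contraTneq rc => ->; rewrite e_irr.
apply: ler_sum => c _; rewrite /drop_to /voltage hit_r le_max; apply/orP; left.
by rewrite le_eqVlt; apply/orP; left; apply/eqP; field.
Qed.

Section Volume.
Variables (L : {fset V}) (s : seq V).
Hypotheses (sL : perm_eq s L) (s_peel : peeling e r s).

Let exposed v : bool := has [pred c | c \notin s] (nbrs e v).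

(** A vertex adjacent to the outer boundary, where the height is 0, has its height confined to
    [[-1, 1]]. *)
Let boundary_weight v (x : R) : R := (exposed v ==> (`|x| <= 1)%R)%:R.

Let compatible (phi : V -> R) : bool :=
  all (fun v => exposed v ==> (`|phi v| <= 1)%R) s &&
  all (fun u => all (fun v => e u v ==> (`|phi u - phi v| <= 1)%R) s) s.

Let prodr_all (T : Type) (p : pred T) (t : seq T) :
  \prod_(i <- t) (p i)%:R = (all p t)%:R :> R.
Proof.
elim: t => [|i t IH]; first by rewrite big_nil.
by rewrite big_cons IH /= -natrM mulnb.
Qed.

Let weightE phi : weight e boundary_weight s phi = (compatible phi)%:R.
Proof.
rewrite /weight /compatible -mulnb natrM; congr (_ * _); first by rewrite -prodr_all.
rewrite -prodr_all; apply: eq_bigr => u _; rewrite -prodr_all; apply: eq_bigr => v _.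
by rewrite /edge_box /box; case: (e u v).
Qed.

(** An exposed vertex carries [box], which decays at every rate; any other has zero outflow, for
    which a constant suffices. *)
Let decay_boundary v : decay (outflow (nbrs e) voltage v s) (boundary_weight v).
Proof.
rewrite /boundary_weight; case: (boolP (exposed v)) => ev /=.
  exact: decay_box (outflow_ge0 _ _ _ _).
rewrite (_ : outflow _ _ _ _ = 0); first exact: decay_cst.
rewrite /outflow big_seq_cond big1// => c /andP[vc cs].
by case/hasP: ev; exists c.
Qed.

Let polytopeE (t : #|` L|.-tuple R) :
  lipschitz_polytope e t <-> compatible (extend0 t).
Proof.
have sLE v : (v \in s) = (v \in L) := perm_mem sL v.
have ext0 v : v \notin L -> extend0 t v = 0.
  by move=> vL; rewrite /extend0 nth_default// size_tuple leqNgt index_mem.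
split.
  move=> H; apply/andP; split; apply/allP => u.
    rewrite sLE => uL; apply/implyP => /hasP[c uc /= cs].
    have cL : c \notin L by rewrite -sLE.
    have ec : e u c by rewrite -(mem_nbrs e_fin).
    have := H u c; rewrite (ext0 _ cL) subr0; apply => //; first by left.
    by right; split => //; exists u.
  rewrite sLE => uL; apply/allP => v; rewrite sLE => vL; apply/implyP => uv.
  by apply: H => //; left.
move=> /andP[/allP H1 /allP H2] u v.
have H3 x y : x \in L -> y \notin L -> e x y -> `|extend0 t x| <= 1.
  move=> xL yL xy; have := H1 x; rewrite sLE => /(_ xL) /implyP; apply.
  by apply/hasP; exists y; [rewrite (mem_nbrs e_fin)|rewrite /= sLE].
case=> [uL|[uL _]] [vL|[vL _]] uv.
- have := H2 u; rewrite sLE => /(_ uL) /allP/(_ v); rewrite sLE => /(_ vL).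
  by move=> /implyP; apply.
- by rewrite (ext0 _ vL) subr0; exact: H3 uL vL uv.
- by rewrite (ext0 _ uL) sub0r normrN; apply: (H3 v u) => //; rewrite e_sym.
- by rewrite (ext0 _ uL) (ext0 _ vL) subrr normr0.
Qed.

(** Here [f] is the unnormalized density of the height at the root; its total integral is the volume
    of the polytope. *)
Lemma polytope_marginal : exists2 f : R -> R,
  decay (outflow (nbrs e) voltage r [:: r]) f &
  forall B : set R, measurable B ->
  lebesgue_tuple (@lipschitz_polytope R V e L `&` [set t | B (extend0 t r)]) =
  (\int[mu]_x (f x * \1_B x)%:E)%E.
Proof.
have [f df fE] := integs_weight e_sym e_irr (fun v => fset_uniq (nbrs e v))
  (mem_nbrs e_fin) voltage_gt0 voltage_sup s_peel (fun v _ => decay_boundary v).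
exists f => // B mB.
have m1B : measurable_fun [set: R] (\1_B : R -> R) by exact: measurable_indic.
rewrite -(fE _ m1B)//.
pose A : set (V -> R) := [set phi | compatible phi /\ B (phi r)].
have AE phi : (\1_A phi)%:E = (weight e boundary_weight s phi * \1_B (phi r))%:E :> \bar R.
  rewrite weightE !indicE -natrM mulnb; congr (_%:R)%:E; congr nat_of_bool.
  apply/idP/andP.
    by rewrite inE => -[? ?]; split => //; rewrite inE.
  by rewrite !inE => -[? ?]; split => //; exact/set_mem.
rewrite -(_ : (fun phi => (\1_A phi)%:E) = (fun phi => (weight e _ _ _ * _)%:E)); last first.
  exact/funext.
(* Tonelli passes from the elimination order to the enumeration of [L] that indexes the tuples. *)
rewrite (perm_integs _ _ sL); last 2 first.
- by move=> phi; rewrite lee_fin.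
- rewrite (funext AE); apply: coord_measurable_weight => // v _.
  exact: measurable_decay (outflow_ge0 _ _ _ _) (decay_boundary v).
rewrite -(lebesgue_tuple_integs A (n := #|` L|) (fun=> 0))// ?fset_uniq//.
have fillE (t : #|` L|.-tuple R) : fill L t (fun=> 0) = extend0 t.
  apply/funext => u; rewrite /fill /extend0; case: ifPn => // uL.
  by rewrite nth_default// size_tuple leqNgt index_mem.
congr lebesgue_tuple; apply/seteqP; split => t /=; rewrite fillE.
  by move=> [/polytopeE].
by move=> [/polytopeE].
Qed.

End Volume.
End Assembly.

Theorem corollary4p10 (R : realType) (V : choiceType) (e : rel V) (vstar : V) :
  is_tree e -> infinite_set [set: V] -> locally_finite e ->
  transient R e vstar ->
  localized R e vstar.
Proof.
move=> e_tree Voo e_fin tr eps eps0.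
have k0 := outflow_root_gt0 e_tree e_fin Voo tr.
set k := outflow _ _ _ _ in k0.
(* With [z >= 1] and [eps * k * z >= 1] one gets [eps * (1 + k * z^2) >= 1]. The extra 1 in [M]
   makes its excess equal to [z]. Neither depends on [L]. *)
pose z : R := 1 + (eps * k)^-1; pose M := z + 1.
have ek0 : 0 < eps * k by rewrite mulr_gt0.
have ek1 : 0 < (eps * k)^-1 by rewrite invr_gt0.
exists `[- M, M]%classic; first exact: segment_compact.
move=> L [rL cL].
have [_ _ _ e_acyclic] := e_tree; have [e_sym _ _ _] := e_tree.
have [s s_peel sL] := exists_peeling e_sym e_acyclic rL cL.
have [f df fE] := polytope_marginal (R := R) e_tree e_fin sL s_peel.
rewrite /lipschitz_law /pushforward /uniform_law.
have mK : measurable (~` `[- M, M]%classic : set R).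
  by apply: measurableC; exact: measurable_itv.
have M0 : 0 <= M by rewrite !addr_ge0// ltW.
have := decay_tail (ltW k0) df M0.
have -> : (fun x => (f x * (M < `|x|)%R%:R)%:E) =
    (fun x => (f x * \1_(~` `[- M, M]%classic) x)%:E).
  apply/funext => x; rewrite indicE in_setC mem_setE in_itv/= -ler_norml.
  by rewrite ltNge.
have -> : (\int[@lebesgue_measure R]_x (f x)%:E =
    \int[@lebesgue_measure R]_x (f x * \1_setT x)%:E)%E.
  by apply: eq_integral => x _; rewrite indicT mulr1.
rewrite -(fE _ mK) -(fE _ measurableT) setIT.
set N := lebesgue_tuple (_ `&` _); set D := lebesgue_tuple _.
have N0 : (0 <= N)%E by exact: measure_ge0.
have D0 : (0 <= D)%E by exact: measure_ge0.
rewrite excessE; last by rewrite lerDr addr_ge0// ltW.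
rewrite addrK; set c := 1 + _.
have ck : 1 <= eps * c.
  have z1 : 1 <= z by rewrite lerDl ltW.
  have ekz : 1 <= eps * k * z by rewrite mulrDr mulr1 divff ?gt_eqF// lerDr ltW.
  rewrite /c mulrDr mulr1 mulrA expr2 mulrA.
  apply: (le_trans ekz); apply: le_trans (ler_peMr (le_trans ler01 ekz) z1) _.
  by rewrite lerDr ltW.
have c0 : 0 < c by rewrite ltr_pwDl// mulr_ge0 ?sqr_ge0// ltW.
(* For infinite or zero volume the normalizing factor is 0, as [fine] of infinity and the inverse of
   0 are both 0, and the bound is trivial. *)
case: D D0 => [d| |] D0 ND //; last first.
  by rewrite /= invr0 mule0 lee_fin ltW.
have [->|d0] := eqVneq d 0; first by rewrite /= invr0 mule0 lee_fin ltW.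
(* An infinite [N] contradicts [c * N <= D] with [D] finite; otherwise [N / D <= 1 / c <= eps]. *)
move: N0 ND; case: N => [n| |] N0 ND //=; last first.
  by move: ND; rewrite mulry gtr0_sg// mul1e.
move: N0 D0 ND; rewrite -!EFinM !lee_fin => N0 D0 ND.
have {}d0 : 0 < d by rewrite lt_neqAle eq_sym d0.
rewrite ler_pdivrMr//; apply: le_trans (ler_wpM2l (ltW eps0) ND).
by rewrite mulrA ler_peMl.
Qed.
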